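(* Let $d$ be a positive integer that is not a perfect square, let $p$ be a prime number and let $z$ be an integer such that $z^2\equiv d\pmod p$. Then the continued fraction $$\left[\,z,\overline{\frac{2z}{d-z^2},\,2z}\,\right]$$ converges to $\sqrt d$ both in the real sense (in $\mathbb R$) and in the $p$-adic sense (in $\mathbb Q_p$), and the Rédei rational functions $Q_n(d,z)$ provide simultaneously real and $p$-adic approximations of $\sqrt d$, i.e. $Q_n(d,z)\to\sqrt d$ as $n\to\infty$ both in $\mathbb R$ and in $\mathbb Q_p$.
   Context: Continued fractions here may have rational partial quotients: $[c_0,c_1,c_2,\ldots]$ denotes $c_0+\cfrac{1}{c_1+\cfrac{1}{c_2+\cdots}}$, its convergents are the finite continued fractions $[c_0,\ldots,c_m]$, $m\ge0$, and convergence in $\mathbb R$ (respectively $\mathbb Q_p$) means convergence of the convergents, which are rational numbers, in $\mathbb R$ (respectively $\mathbb Q_p$). An overline denotes a block repeated periodically, so the continued fraction above has partial quotients $c_0=z$, $c_{2k-1}=\frac{2z}{d-z^2}$ and $c_{2k}=2z$ for $k\ge1$. For $d$ a positive nonsquare integer and $z$ an integer, the integers $N_n(d,z)$, $D_n(d,z)$ are defined by $(z+\sqrt d)^n=N_n(d,z)+D_n(d,z)\sqrt d$, i.e. $N_n(d,z)=\sum_{i\ge 0}\binom{n}{2i}d^iz^{n-2i}$ and $D_n(d,z)=\sum_{i\ge 0}\binom{n}{2i+1}d^iz^{n-2i-1}$ (terms with zero binomial coefficient are omitted). The Rédei rational functions are $Q_n(d,z)=N_n(d,z)/D_n(d,z)$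 for $n\ge1$. In $\mathbb Q_p$, $\sqrt d$ denotes an element of $\mathbb Q_p$ whose square is $d$.
   Formalization: Assumes z ≠ 0 (else divisions by zero); the real limit is sgn(z)√d, i.e. −√d for z < 0; when p divides 2z the p-adic claim additionally requires |z²−d|_p < |2z|_p², which is necessary (e.g. p=2, d=3, z=1 fails). *)

(* Defs.v *)
From HB Require Import structures.
From mathcomp Require Import all_boot all_order all_algebra.
From mathcomp Require Import ring_quotient.
From mathcomp Require Import all_classical all_reals all_analysis.
From mathcomp Require Import ring lra zify.
Set Implicit Arguments.
Unset Strict Implicit.
Unset Printing Implicit Defensive.
Import Order.TTheory GRing.Theory Num.Theory.
Import numFieldNormedType.Exports.
Local Open Scope classical_set_scope.
Local Open Scope ring_scope.

Definition padic_norm (p : nat) (x : rat) : rat :=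
  if x == 0 then 0
  else p%:R ^ ((logn p `|denq x|)%:Z - (logn p `|numq x|)%:Z).

Section PadicNorm.
Variables (p : nat) (p_pr : prime p).
Local Notation nm := (padic_norm p).

Let p_gt0 : (0 : rat) < p%:R. Proof. by rewrite ltr0n prime_gt0. Qed.
Let p_neq0 : (p%:R : rat) != 0. Proof. by rewrite gt_eqF. Qed.
Let p_gt1 : (1 : rat) < p%:R. Proof. by rewrite ltr1n prime_gt1. Qed.

Lemma padic_norm0 : nm 0 = 0. Proof. by rewrite /padic_norm eqxx. Qed.

Lemma padic_norm_frac (a b : int) : a != 0 -> b != 0 ->
  nm (a%:~R / b%:~R) = p%:R ^ ((logn p `|b|)%:Z - (logn p `|a|)%:Z).
Proof.
move=> a0 b0; set x : rat := _ / _.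
have x0 : x != 0 by rewrite mulf_neq0 ?invr_eq0 ?intr_eq0.
rewrite /padic_norm (negbTE x0).
have nx0 : numq x != 0 by rewrite numq_eq0.
have dx0 : denq x != 0 by rewrite denq_neq0.
have E : a * denq x = numq x * b.
  apply: (@intr_inj rat); rewrite !intrM.
  have bq : (b%:~R : rat) != 0 by rewrite intr_eq0.
  have dq : ((denq x)%:~R : rat) != 0 by rewrite intr_eq0.
  have := divq_num_den x; rewrite {3}/x => /eqP.
  by rewrite eqr_div // => /eqP ->.
have : logn p `|a * denq x| = logn p `|numq x * b| by rewrite E.
rewrite !abszM !lognM ?absz_gt0 // => EL.
by congr (_ ^ _); lia.
Qed.

Lemma padic_norm_int (a : int) : a != 0 ->
  nm a%:~R = p%:R ^ (- (logn p `|a|)%:Z).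
Proof.
by move=> a0; rewrite -[a%:~R]divr1 (padic_norm_frac a0 (b := 1)) // logn1 sub0r.
Qed.

Lemma padic_norm_gt0 x : (0 < nm x) = (x != 0).
Proof.
rewrite /padic_norm; case: eqP => [|_] /=; first by rewrite ltxx.
by rewrite exprz_gt0.
Qed.

Lemma padic_norm_eq0 x : (nm x == 0) = (x == 0).
Proof.
case: (eqVneq x 0) => [->|x0]; first by rewrite padic_norm0 eqxx.
by rewrite gt_eqF // padic_norm_gt0.
Qed.

Lemma padic_norm_ge0 x : 0 <= nm x.
Proof.
by rewrite /padic_norm; case: eqP => // _; rewrite ltW // exprz_gt0.
Qed.

Lemma padic_normM x y : nm (x * y) = nm x * nm y.
Proof.
have [->|x0] := eqVneq x 0; first by rewrite !(mul0r, padic_norm0).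
have [->|y0] := eqVneq y 0; first by rewrite !(mulr0, padic_norm0).
have nx0 : numq x != 0 by rewrite numq_eq0.
have ny0 : numq y != 0 by rewrite numq_eq0.
have dx0 := denq_neq0 x; have dy0 := denq_neq0 y.
rewrite -{1}[x]divq_num_den -{1}[y]divq_num_den mulf_div -!intrM.
rewrite padic_norm_frac ?mulf_neq0 // !abszM !lognM ?absz_gt0 //.
rewrite /padic_norm (negbTE x0) (negbTE y0) -expfzDr //.
by congr (_ ^ _); lia.
Qed.

Lemma padic_norm1 : nm 1 = 1.
Proof. by rewrite (padic_norm_int (a := 1)) // logn1. Qed.

Lemma padic_normN x : nm (- x) = nm x.
Proof.
rewrite -mulN1r padic_normM (padic_norm_int (a := -1)) //.
by rewrite logn1 mul1r.
Qed.

Lemma padic_normB x y : nm (x - y) = nm (y - x).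
Proof. by rewrite -opprB padic_normN. Qed.

Lemma padic_normV x : nm x^-1 = (nm x)^-1.
Proof.
have [->|x0] := eqVneq x 0; first by rewrite padic_norm0 invr0 padic_norm0.
have nx0 : nm x != 0 by rewrite padic_norm_eq0.
by apply: (mulfI nx0); rewrite -padic_normM !mulfV // padic_norm1.
Qed.

Lemma padic_normD x y : nm (x + y) <= Num.max (nm x) (nm y).
Proof.
have [->|x0] := eqVneq x 0; first by rewrite add0r le_max lexx orbT.
have [->|y0] := eqVneq y 0; first by rewrite addr0 le_max lexx.
have [->|s0] := eqVneq (x + y) 0.
  by rewrite padic_norm0 le_max padic_norm_ge0.
pose c := denq x * denq y.
pose a := numq x * denq y; pose b := numq y * denq x.
have dx0 := denq_neq0 x; have dy0 := denq_neq0 y.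
have c0 : c != 0 by rewrite mulf_neq0.
have a0 : a != 0 by rewrite mulf_neq0 ?numq_eq0.
have b0 : b != 0 by rewrite mulf_neq0 ?numq_eq0.
have dxq : ((denq x)%:~R : rat) != 0 by rewrite intr_eq0.
have dyq : ((denq y)%:~R : rat) != 0 by rewrite intr_eq0.
have Ex : x = a%:~R / c%:~R.
  by rewrite -{1}[x]divq_num_den /a /c !intrM; field; rewrite dxq dyq.
have Ey : y = b%:~R / c%:~R.
  by rewrite -{1}[y]divq_num_den /b /c !intrM; field; rewrite dxq dyq.
have Es : x + y = (a + b)%:~R / c%:~R by rewrite Ex Ey intrD mulrDl.
have ab0 : a + b != 0.
  by apply: contra_neq s0 => ab; rewrite Es ab mul0r.
rewrite Es {1}Ex {1}Ey !padic_norm_frac // le_max.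
rewrite !ler_eXz2l //.
suff : (minn (logn p `|a|) (logn p `|b|) <= logn p `|(a + b)%R|)%N by lia.
set k := minn _ _; rewrite -(@pfactor_dvdn p k) ?absz_gt0 //.
change (is_true ((p ^ k)%N%:Z %| a + b)%Z).
by apply: rpredD; rewrite dvdzE absz_nat pfactor_dvdn ?absz_gt0 //
  ?geq_minl ?geq_minr.
Qed.

End PadicNorm.

Definition padic_cauchy (p : nat) (p_pr : prime p) (u : nat -> rat) : bool :=
  `[< forall e : rat, 0 < e -> exists N : nat, forall m n : nat,
        (N <= m)%N -> (N <= n)%N -> padic_norm p (u m - u n) < e >].

Section PadicCauchy.
Variables (p : nat) (p_pr : prime p).
Local Notation nm := (padic_norm p).

Lemma padic_normD_lt x y e : nm x < e -> nm y < e -> nm (x + y) < e.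
Proof.
move=> xe ye; apply: le_lt_trans (padic_normD p_pr x y) _.
by rewrite gt_max xe ye.
Qed.

Lemma padic_norm_isosceles x y : nm (x - y) < nm y -> nm x = nm y.
Proof.
move=> xy; apply/eqP; rewrite eq_le; apply/andP; split.
  rewrite -{1}(subrK y x); apply: le_trans (padic_normD p_pr _ _) _.
  by rewrite ge_max lexx (ltW xy).
rewrite leNgt; apply/negP => yx.
have : nm y < nm y; last by rewrite ltxx.
rewrite -{1}(subKr x y); apply: padic_normD_lt => //.
by rewrite padic_normN.
Qed.

Lemma padic_cauchyP u : reflect
  (forall e : rat, 0 < e -> exists N : nat, forall m n : nat,
     (N <= m)%N -> (N <= n)%N -> nm (u m - u n) < e) (padic_cauchy p_pr u).
Proof. exact: asboolP. Qed.

Lemma padic_cauchy_bounded u : padic_cauchy p_pr u ->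
  exists2 M : rat, 0 < M & forall n, nm (u n) <= M.
Proof.
move=> /padic_cauchyP /(_ 1 ltr01)[N uN].
pose M := 1 + nm (u N) + \sum_(i < N) nm (u i).
have S0 : 0 <= \sum_(i < N) nm (u i).
  by apply: sumr_ge0 => i _; exact: padic_norm_ge0.
have uN0 : 0 <= nm (u N) by exact: padic_norm_ge0.
exists M => [|n]; first by rewrite /M; lra.
have [nN|Nn] := ltnP n N.
  rewrite /M (bigD1 (Ordinal nN)) //= addrCA lerDl addr_ge0 //; first lra.
  by apply: sumr_ge0 => i _; exact: padic_norm_ge0.
rewrite -(subrK (u N) (u n)); apply: le_trans (padic_normD p_pr _ _) _.
have := uN n N Nn (leqnn N); rewrite ge_max /M => H.
by apply/andP; split; lra.
Qed.

Lemma padic_cauchy_subring : GRing.subring_closed (padic_cauchy p_pr).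
Proof.
split=> [|u v|u v].
- by apply/padic_cauchyP => e e0; exists 0%N => m n _ _; rewrite subrr padic_norm0.
- move=> /padic_cauchyP Hu /padic_cauchyP Hv; apply/padic_cauchyP => e e0.
  have [N1 H1] := Hu e e0; have [N2 H2] := Hv e e0.
  exists (maxn N1 N2) => m n; rewrite !geq_max => /andP[m1 m2] /andP[n1 n2].
  have -> : (u - v) m - (u - v) n = (u m - u n) - (v m - v n).
    by change (u m - v m - (u n - v n) = (u m - u n) - (v m - v n)); ring.
  by apply: padic_normD_lt; rewrite ?padic_normN ?H1 ?H2.
- move=> cu cv; have [A A0 HA] := padic_cauchy_bounded cu.
  have [B B0 HB] := padic_cauchy_bounded cv.
  move: cu cv => /padic_cauchyP Hu /padic_cauchyP Hv; apply/padic_cauchyP => e e0.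
  have [N1 H1] := Hu (e / B) (divr_gt0 e0 B0).
  have [N2 H2] := Hv (e / A) (divr_gt0 e0 A0).
  exists (maxn N1 N2) => m n; rewrite !geq_max => /andP[m1 m2] /andP[n1 n2].
  have -> : (u * v) m - (u * v) n = (u m - u n) * v m + u n * (v m - v n).
    by change (u m * v m - u n * v n = (u m - u n) * v m + u n * (v m - v n)); ring.
  apply: padic_normD_lt; rewrite padic_normM //.
    apply: le_lt_trans (_ : nm (u m - u n) * B < e).
      by rewrite ler_wpM2l ?padic_norm_ge0 ?HB.
    by rewrite -ltr_pdivlMr // H1.
  apply: le_lt_trans (_ : A * nm (v m - v n) < e).
    by rewrite ler_wpM2r ?padic_norm_ge0 ?HA.
  by rewrite mulrC -ltr_pdivlMr // H2.
Qed.

HB.instance Definition _ :=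
  GRing.isSubringClosed.Build (nat -> rat) (padic_cauchy p_pr) padic_cauchy_subring.

End PadicCauchy.

Record padic_seq (p : nat) (p_pr : prime p) :=
  PadicSeq { padic_seq_val :> nat -> rat; _ : padic_cauchy p_pr padic_seq_val }.

HB.instance Definition _ p (p_pr : prime p) :=
  [isSub for @padic_seq_val p p_pr].
HB.instance Definition _ p (p_pr : prime p) :=
  [Choice of padic_seq p_pr by <:].
HB.instance Definition _ p (p_pr : prime p) :=
  [SubChoice_isSubComNzRing of padic_seq p_pr by <:].

Definition padic_null (p : nat) (p_pr : prime p) (u : padic_seq p_pr) : bool :=
  `[< forall e : rat, 0 < e ->
        exists N : nat, forall n, (N <= n)%N -> padic_norm p (u n) < e >].

Section PadicNull.
Variables (p : nat) (p_pr : prime p).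
Local Notation nm := (padic_norm p).
Implicit Types u v : padic_seq p_pr.

Lemma padic_nullP u : reflect (forall e : rat, 0 < e ->
  exists N : nat, forall n, (N <= n)%N -> nm (u n) < e) (padic_null u).
Proof. exact: asboolP. Qed.

Lemma padic_seqP u : padic_cauchy p_pr u. Proof. by case: u. Qed.

Lemma padic_null_ideal : idealr_closed (@padic_null p p_pr).
Proof.
split=> [||a u v].
- by apply/padic_nullP => e e0; exists 0%N => n _; rewrite padic_norm0.
- apply/negP => /padic_nullP /(_ 1 ltr01)[N /(_ N (leqnn N))].
  by rewrite padic_norm1 // ltxx.
- move=> /padic_nullP Hu /padic_nullP Hv; apply/padic_nullP => e e0.
  have [A A0 HA] := padic_cauchy_bounded (padic_seqP a).
  have [N1 H1] := Hu (e / A) (divr_gt0 e0 A0); have [N2 H2] := Hv e e0.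
  exists (maxn N1 N2) => n; rewrite !geq_max => /andP[n1 n2].
  rewrite [(a * u + v) n]/(a n * u n + v n).
  apply: padic_normD_lt; rewrite ?H2 // padic_normM //.
  apply: le_lt_trans (_ : A * nm (u n) < e).
    by rewrite ler_wpM2r ?padic_norm_ge0 ?HA.
  by rewrite mulrC -ltr_pdivlMr // H1.
Qed.

HB.instance Definition _ :=
  isIdealr.Build (padic_seq p_pr) (@padic_null p p_pr) padic_null_ideal.

Lemma padic_notnull_evconst u : ~~ padic_null u ->
  exists2 c : rat, 0 < c & exists N, forall n, (N <= n)%N -> nm (u n) = c.
Proof.
move=> /asboolPn /existsNP[e /not_implyP[e0 /forallNP He]].
have /padic_cauchyP /(_ e e0)[N HN] := padic_seqP u.
have /existsNP[n0 /not_implyP[n0N /negP]] := He N; rewrite -leNgt => en0.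
exists (nm (u n0)); first exact: lt_le_trans en0.
exists N => n nN; apply: padic_norm_isosceles => //.
exact: lt_le_trans (HN _ _ nN n0N) en0.
Qed.

End PadicNull.

(* Q_p: p-adic Cauchy sequences of rationals modulo p-adic null sequences *)
Definition Qp (p : nat) (p_pr : prime p) : Type :=
  {ideal_quot (@padic_null p p_pr : idealr (padic_seq p_pr))}.

HB.instance Definition _ p (p_pr : prime p) := GRing.ComNzRing.on (Qp p_pr).

Section QpField.
Variables (p : nat) (p_pr : prime p).
Local Notation nm := (padic_norm p).
Local Notation Qp := (Qp p_pr).
Local Notation cl := (\pi_(Qp)%qT : padic_seq p_pr -> Qp).

Lemma Qp_eqP (u v : padic_seq p_pr) : reflect (cl u = cl v) (padic_null (u - v)).
Proof.
have E : padic_null (u - v) = (cl u == cl v).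
  exact: (Quotient.idealrBE (@padic_null p p_pr : idealr _) u v).
by rewrite E; exact: eqP.
Qed.

Lemma Qp_reprK (x : Qp) : cl (repr x) = x. Proof. exact: reprK. Qed.

Lemma Qp_piD u v : cl (u + v) = cl u + cl v. Proof. exact: rmorphD. Qed.
Lemma Qp_piB u v : cl (u - v) = cl u - cl v. Proof. exact: rmorphB. Qed.
Lemma Qp_piM u v : cl (u * v) = cl u * cl v. Proof. exact: rmorphM. Qed.
Lemma Qp_pi0 : cl 0 = 0. Proof. exact: rmorph0. Qed.
Lemma Qp_pi1 : cl 1 = 1. Proof. exact: rmorph1. Qed.

Lemma Qp_eq0P (u : padic_seq p_pr) : reflect (cl u = 0) (padic_null u).
Proof. by rewrite -{2}[u]subr0 -Qp_pi0; apply: Qp_eqP. Qed.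

Lemma Qp_inv_ex (x : Qp) : x != 0 -> exists y : Qp, y * x = 1.
Proof.
move=> x0; set u := repr x.
have nu : ~~ padic_null u.
  by apply: contra_neqN x0 => /Qp_eq0P; rewrite Qp_reprK.
have [c c0 [N HN]] := padic_notnull_evconst nu.
have un0 n : (N <= n)%N -> u n != 0.
  by move=> Nn; rewrite -(padic_norm_eq0 p_pr) HN // gt_eqF.
have cv : padic_cauchy p_pr (fun n => (u n)^-1).
  apply/padic_cauchyP => e e0.
  have /padic_cauchyP /(_ (e * (c * c))) := padic_seqP u.
  case=> [|M HM]; first by rewrite !mulr_gt0.
  exists (maxn N M) => m n; rewrite !geq_max => /andP[m1 m2] /andP[n1 n2].
  have -> : (u m)^-1 - (u n)^-1 = (u n - u m) * ((u m)^-1 * (u n)^-1).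
    by field; rewrite !un0.
  rewrite !padic_normM // !padic_normV // !HN // -invfM ltr_pdivrMr ?mulr_gt0 //.
  exact: HM.
exists (cl (PadicSeq cv)); rewrite -[x]Qp_reprK -Qp_piM -Qp_pi1.
apply/Qp_eqP/padic_nullP => e e0; exists N => n Nn.
change (nm ((u n)^-1 * u n - 1) < e).
by rewrite mulVf ?un0 // subrr padic_norm0.
Qed.

Definition Qp_inv (x : Qp) : Qp :=
  if x == 0 then 0 else xget 0 [set y | y * x = 1].

Lemma Qp_mulVf (x : Qp) : x != 0 -> Qp_inv x * x = 1.
Proof.
move=> x0; rewrite /Qp_inv (negbTE x0).
exact: (xgetPex 0 (Qp_inv_ex x0)).
Qed.

Lemma Qp_inv0 : Qp_inv 0 = 0. Proof. by rewrite /Qp_inv eqxx. Qed.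

HB.instance Definition _ := GRing.ComNzRing_isField.Build Qp Qp_mulVf Qp_inv0.

(* |u_n|_p is eventually constant unless u is null; the default is then |0| *)
Definition Qp_norm (x : Qp) : rat :=
  xget 0 [set c | exists N, forall n, (N <= n)%N -> nm (repr x n) = c].

Lemma Qp_norm_pi (u : padic_seq p_pr) (c : rat) : 0 < c ->
  (exists N, forall n, (N <= n)%N -> nm (u n) = c) -> Qp_norm (cl u) = c.
Proof.
move=> c0 [N HN]; apply: xget_unique => /=.
  have /Qp_eqP /padic_nullP /(_ c c0)[M HM] : cl (repr (cl u)) = cl u.
    exact: Qp_reprK.
  exists (maxn N M) => n; rewrite geq_max => /andP[n1 n2].
  rewrite -(HN n n1); apply: (padic_norm_isosceles p_pr).
  by rewrite (HN n n1); exact: HM.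
move=> b [M HM].
have /Qp_eqP /padic_nullP /(_ c c0)[K HK] : cl (repr (cl u)) = cl u.
  exact: Qp_reprK.
pose n := maxn (maxn N M) K.
have [nN nM nK] : [/\ N <= n, M <= n & K <= n]%N by rewrite /n; split; lia.
rewrite -(HM n nM) -(HN n nN); apply: (padic_norm_isosceles p_pr).
by rewrite (HN n nN); exact: HK.
Qed.

Lemma Qp_norm0 : Qp_norm 0 = 0.
Proof.
rewrite /Qp_norm; case: xgetP => // c _ [N HN].
have /padic_nullP H : padic_null (repr (0 : Qp)) by apply/Qp_eq0P/Qp_reprK.
apply/eqP; rewrite eq_le -(HN N (leqnn N)) padic_norm_ge0 // andbT.
apply/ler_addgt0Pl => e e0; have [M HM] := H e e0.
rewrite (HN N (leqnn N)) -(HN (maxn N M)) ?leq_maxl // addr0 ltW // HM //.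
exact: leq_maxr.
Qed.

Lemma Qp_norm_repr (x : Qp) : x != 0 ->
  exists2 u : padic_seq p_pr, x = cl u & 0 < Qp_norm x /\
    exists N, forall n, (N <= n)%N -> nm (u n) = Qp_norm x.
Proof.
move=> x0; exists (repr x); first by rewrite Qp_reprK.
have nu : ~~ padic_null (repr x : padic_seq p_pr).
  by apply: contra_neqN x0 => /Qp_eq0P; rewrite Qp_reprK.
have [c c0 HN] := padic_notnull_evconst nu.
by have -> : Qp_norm x = c by rewrite -[in LHS](Qp_reprK x) (Qp_norm_pi c0 HN).
Qed.

Lemma Qp_norm_gt0 x : (0 < Qp_norm x) = (x != 0).
Proof.
have [->|x0] := eqVneq x 0; first by rewrite Qp_norm0 ltxx.
by have [u _ [-> _]] := Qp_norm_repr x0.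
Qed.

Lemma Qp_norm_ge0 x : 0 <= Qp_norm x.
Proof.
have [->|x0] := eqVneq x 0; first by rewrite Qp_norm0.
by rewrite ltW // Qp_norm_gt0.
Qed.

Lemma Qp_norm_eq0 x : (Qp_norm x == 0) = (x == 0).
Proof.
have [->|x0] := eqVneq x 0; first by rewrite Qp_norm0 eqxx.
by rewrite gt_eqF // Qp_norm_gt0.
Qed.

Lemma Qp_normM x y : Qp_norm (x * y) = Qp_norm x * Qp_norm y.
Proof.
have [->|x0] := eqVneq x 0; first by rewrite !(mul0r, Qp_norm0).
have [->|y0] := eqVneq y 0; first by rewrite !(mulr0, Qp_norm0).
have [u xu [c0 [N HN]]] := Qp_norm_repr x0.
have [v yv [b0 [M HM]]] := Qp_norm_repr y0.
rewrite {1}xu {1}yv -Qp_piM; apply: Qp_norm_pi; first exact: mulr_gt0.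
exists (maxn N M) => n; rewrite geq_max => /andP[n1 n2].
by rewrite [(u * v) n]/(u n * v n) padic_normM // HN // HM.
Qed.

Lemma Qp_normD x y : Qp_norm (x + y) <= Num.max (Qp_norm x) (Qp_norm y).
Proof.
have [->|x0] := eqVneq x 0; first by rewrite add0r le_max lexx orbT.
have [->|y0] := eqVneq y 0; first by rewrite addr0 le_max lexx.
have [->|s0] := eqVneq (x + y) 0; first by rewrite Qp_norm0 le_max Qp_norm_ge0.
have [u xu [c0 [N HN]]] := Qp_norm_repr x0.
have [v yv [b0 [M HM]]] := Qp_norm_repr y0.
have : ~~ padic_null (u + v).
  by apply: contra_neqN s0 => /Qp_eq0P; rewrite Qp_piD -xu -yv.
move=> /padic_notnull_evconst[c c1 [K HK]].
rewrite {1}xu {1}yv -Qp_piD (Qp_norm_pi c1 (ex_intro _ K HK)).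
pose n := maxn (maxn N M) K.
have [nN nM nK] : [/\ N <= n, M <= n & K <= n]%N by rewrite /n; split; lia.
by rewrite -(HN n nN) -(HM n nM) -(HK n nK); exact: padic_normD.
Qed.

Lemma Qp_normN x : Qp_norm (- x) = Qp_norm x.
Proof.
have N1 : Qp_norm (-1) = 1.
  have : Qp_norm (-1) ^+ 2 == 1 ^+ 2.
    rewrite expr2 -Qp_normM mulrNN mulr1 expr1n -Qp_pi1; apply/eqP.
    apply: Qp_norm_pi => //; exists 0%N => n _.
    by change (nm 1 = 1); rewrite padic_norm1.
  by rewrite eqrXn2 ?Qp_norm_ge0 // => /eqP.
by rewrite -mulN1r Qp_normM N1 mul1r.
Qed.

Definition Qp_dist (x y : Qp) : rat := Qp_norm (x - y).

Let Qp_distxx x : Qp_dist x x = 0. Proof. by rewrite /Qp_dist subrr Qp_norm0. Qed.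

Let Qp_dist_eq0 x y : Qp_dist x y = 0 -> x = y.
Proof. by move=> /eqP; rewrite Qp_norm_eq0 subr_eq0 => /eqP. Qed.

Let Qp_dist_sym x y : Qp_dist x y = Qp_dist y x.
Proof. by rewrite /Qp_dist -opprB Qp_normN. Qed.

Let Qp_dist_triangle y x z : Qp_dist x z <= Qp_dist x y + Qp_dist y z.
Proof.
rewrite /Qp_dist -{1}(subrK y x) -addrA.
apply: le_trans (Qp_normD _ _) _.
by rewrite ge_max lerDl lerDr !Qp_norm_ge0.
Qed.

HB.instance Definition _ := isPointed.Build Qp 0.
HB.instance Definition _ :=
  isMetric.Build rat Qp Qp_distxx Qp_dist_eq0 Qp_dist_sym Qp_dist_triangle.

Lemma Qp_mdistE (x y : Qp) : mdist x y = Qp_norm (x - y). Proof. by []. Qed.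

Lemma padic_cauchy_cst (a : rat) : padic_cauchy p_pr (fun=> a).
Proof.
by apply/padic_cauchyP => e e0; exists 0%N => m n _ _; rewrite subrr padic_norm0.
Qed.

Definition Qp_cst (a : rat) : Qp := cl (PadicSeq (padic_cauchy_cst a)).

Lemma Qp_cst_zmod_morphism : zmod_morphism Qp_cst.
Proof. by move=> x y; rewrite /Qp_cst -Qp_piB; congr (cl _); exact: val_inj. Qed.

Lemma Qp_cst_monoid_morphism : monoid_morphism Qp_cst.
Proof.
split; first by rewrite -Qp_pi1; congr (cl _); exact: val_inj.
by move=> x y; rewrite /Qp_cst -Qp_piM; congr (cl _); exact: val_inj.
Qed.

HB.instance Definition _ :=
  GRing.isZmodMorphism.Build rat Qp Qp_cst Qp_cst_zmod_morphism.
HB.instance Definition _ :=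
  GRing.isMonoidMorphism.Build rat Qp Qp_cst Qp_cst_monoid_morphism.

Lemma Qp_cstE : Qp_cst =1 ratr. Proof. exact: fmorph_eq_rat. Qed.

Lemma Qp_norm_ratr (a : rat) : Qp_norm (ratr a) = nm a.
Proof.
rewrite -Qp_cstE.
have [->|a0] := eqVneq a 0.
  by rewrite rmorph0 Qp_norm0 padic_norm0.
by apply: Qp_norm_pi; [rewrite (padic_norm_gt0 p_pr)|exists 0%N].
Qed.

Lemma Qp_seq_lim (u : padic_seq p_pr) :
  (fun n => ratr (u n) : Qp) @ \oo --> cl u.
Proof.
apply/(@metricType_numDomainType.cvgrPdist_lt rat Qp) => e e0.
have /padic_cauchyP /(_ e e0)[N HN] := padic_seqP u.
exists N => // n /= Nn; rewrite Qp_mdistE -Qp_cstE /Qp_cst -Qp_piB.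
set v := (_ - _ : padic_seq p_pr).
have [/Qp_eq0P -> | nv] := boolP (padic_null v); first by rewrite Qp_norm0.
have [c c0 [M HM]] := padic_notnull_evconst nv.
rewrite (Qp_norm_pi c0 (ex_intro _ M HM)) -(HM (maxn N M)) ?leq_maxr //.
by change (nm (u (maxn N M) - u n) < e); apply: HN => //; exact: leq_maxl.
Qed.

(* Qp_norm_ratr, Qp_dense and Qp_complete: Qp is the completion of rat for
   padic_norm p *)
Lemma Qp_dense (x : Qp) (e : rat) : 0 < e ->
  exists a : rat, Qp_norm (x - ratr a) < e.
Proof.
move=> e0; have := @Qp_seq_lim (repr x); rewrite Qp_reprK.
move=> /(@metricType_numDomainType.cvgrPdist_lt rat Qp) /(_ e e0)[N _ HN].
by exists (repr x N); apply: (HN N) => /=.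
Qed.

Lemma Qp_complete (x : nat -> Qp) :
  (forall e : rat, 0 < e -> exists N : nat, forall m n : nat,
     (N <= m)%N -> (N <= n)%N -> Qp_norm (x m - x n) < e) ->
  exists l : Qp, x @ \oo --> l.
Proof.
move=> Hx.
have inv_gt0 n : (0 : rat) < n.+1%:R^-1 by rewrite invr_gt0 ltr0n.
have [r Hr] := choice (fun n => Qp_dense (x n) (inv_gt0 n)).
have small (e : rat) : 0 < e -> exists N, forall n, (N <= n)%N -> n.+1%:R^-1 < e.
  move=> e0; exists (Num.bound e^-1) => n Nn.
  rewrite invf_plt ?posrE ?ltr0n //.
  have := archi_boundP (ltW (etrans (invr_gt0 e) e0)) => H.
  by apply: lt_le_trans H _; rewrite ler_nat ltnW.
have tri a b e : Qp_norm a < e -> Qp_norm b < e -> Qp_norm (a + b) < e.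
  move=> ae be; apply: le_lt_trans (Qp_normD _ _) _.
  by rewrite gt_max ae be.
have cr : padic_cauchy p_pr r.
  apply/padic_cauchyP => e e0; have [N HN] := Hx e e0; have [M HM] := small e e0.
  exists (maxn N M) => m n; rewrite !geq_max => /andP[m1 m2] /andP[n1 n2].
  rewrite -Qp_norm_ratr -Qp_cstE rmorphB /= !Qp_cstE.
  have -> : (ratr (r m) - ratr (r n) : Qp) =
    - (x m - ratr (r m)) + ((x m - x n) + (x n - ratr (r n))) by ring.
  apply: (tri _ _ _); first by rewrite Qp_normN (lt_trans (Hr m)) // HM.
  by apply: (tri _ _ _); [exact: HN|rewrite (lt_trans (Hr n)) // HM].
exists (cl (PadicSeq cr)).
apply/(@metricType_numDomainType.cvgrPdist_lt rat Qp) => e e0.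
have /(@metricType_numDomainType.cvgrPdist_lt rat Qp) /(_ e e0)[N _ HN] :=
  @Qp_seq_lim (PadicSeq cr).
have [M HM] := small e e0; exists (maxn N M) => // n /=.
rewrite geq_max => /andP[n1 n2]; rewrite Qp_mdistE.
rewrite -(subrKA (ratr (r n))); apply: (tri _ _ _); first exact: (HN n n1).
by rewrite -opprB Qp_normN (lt_trans (Hr n)) // HM.
Qed.

End QpField.

(* cf a s is [a, s_0, s_1, ...]; as 0^-1 = 0, it is a genuine continued
   fraction only under cf_defined, i.e. when no division by 0 occurs in it *)
Fixpoint cf (a : rat) (s : seq rat) : rat :=
  if s is b :: s' then a + (cf b s')^-1 else a.

Fixpoint cf_defined (a : rat) (s : seq rat) : bool :=
  if s is b :: s' then (cf b s' != 0) && cf_defined b s' else true.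

Definition convergent (c : nat -> rat) (m : nat) : rat :=
  cf (c 0%N) [seq c i | i <- iota 1 m].

Definition convergent_defined (c : nat -> rat) (m : nat) : bool :=
  cf_defined (c 0%N) [seq c i | i <- iota 1 m].

(* partial quotients of [z, (2z/(d-z^2), 2z)^overline] *)
Definition sqrt_quotient (d z : int) (k : nat) : rat :=
  if k == 0%N then z%:~R
  else if odd k then (2 * z)%:~R / (d - z ^+ 2)%:~R
  else (2 * z)%:~R.

(* (z + sqrt d)^n = redeiN d z n + redeiD d z n * sqrt d;
   truncated exponents only occur next to a zero binomial coefficient *)
Definition redeiN (d z : int) (n : nat) : int :=
  \sum_(i < n.+1) 'C(n, i.*2)%:Z * d ^+ i * z ^+ (n - i.*2).

Definition redeiD (d z : int) (n : nat) : int :=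
  \sum_(i < n.+1) 'C(n, i.*2.+1)%:Z * d ^+ i * z ^+ (n - i.*2 - 1).

Definition redeiQ (d z : int) (n : nat) : rat :=
  (redeiN d z n)%:~R / (redeiD d z n)%:~R.

(* Main.v *)
Require Import Defs.
From mathcomp Require Import all_boot all_order all_algebra.
From mathcomp Require Import all_classical all_reals all_analysis.
From mathcomp Require Import ring lra zify.
Import Order.TTheory GRing.Theory Num.Theory.
Import numFieldNormedType.Exports.
Local Open Scope classical_set_scope.
Local Open Scope ring_scope.

(** By Pascal's rule, Q_{n+1} = g(Q_n) for n > 0, g(x) = (z x + d) / (x + z); peeling
    one period off the continued fraction is the map g o g, so the m-th
    convergent is Q_{m+1}. As z Q_n > 0 for n > 0, no denominator vanishes.

    Over R, with s the square root of d having the sign of z and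
    r = (z - s) / (z + s), the binomial theorem gives
    Q_n = s (1 + r^n) / (1 - r^n), and |r| < 1.

    Over Q_p no root is needed beforehand: on the ball |x - z| < |2z| one has
    |x + z| = |2z|, so g maps the ball to itself, contracts distances by
    k = |z^2 - d| / |2z|^2 < 1, and also multiplies |x^2 - d| by k. Hence Q_n is
    Cauchy and its limit squares to d. *)

(** * Recurrences and signs of the Rédei numbers *)

Lemma redeiN0 d z : redeiN d z 0 = 1.
Proof. by rewrite /redeiN big_ord1 /= bin0 expr0 !mulr1. Qed.

Lemma redeiD0 d z : redeiD d z 0 = 0.
Proof. by rewrite /redeiD big_ord1 /= bin_small // !mul0r. Qed.

Lemma redeiNS d z n :
  redeiN d z n.+1 = z * redeiN d z n + d * redeiD d z n.
Proof.
(* [F] is the summand of [redeiN d z n.+1] with upper index [n] in the binomial: one of the two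
   halves given by Pascal's rule. *)
pose F i := 'C(n, i.*2)%:Z * d ^+ i * z ^+ (n.+1 - i.*2).
have -> : z * redeiN d z n = \sum_(i < n.+2) F i.
  rewrite big_ord_recr /= {2}/F bin_small; last by lia.
  rewrite !mul0r addr0 /redeiN mulr_sumr; apply: eq_bigr => i _; rewrite /F.
  have [le_in|lt_ni] := leqP i.*2 n; last by rewrite bin_small // !mul0r mulr0.
  by rewrite subSn // exprS mulrCA.
(* The term of index 0 has no second half; in the others, the shift of [i] by one turns
   ['C(n, 2i+1)] into the terms of [d * redeiD d z n]. *)
rewrite /redeiN big_ord_recl [in RHS]big_ord_recl /= /F !bin0 -addrA.
congr (_ + _); rewrite /redeiD mulr_sumr -big_split /=.
apply: eq_bigr => i _; rewrite ?lift0 /bump ?add1n doubleS binS PoszD !mulrDl; congr (_ + _).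
by rewrite exprS subSS -subnDA addn1; ring.
Qed.

Lemma redeiDS d z n : redeiD d z n.+1 = redeiN d z n + z * redeiD d z n.
Proof.
rewrite /redeiD big_ord_recr /= bin_small; last by lia.
rewrite !mul0r addr0 /redeiN mulr_sumr -big_split /=.
apply: eq_bigr => i _; rewrite binS PoszD !mulrDl addrC; congr (_ + _); last first.
  by have -> : (n.+1 - i.*2 - 1 = n - i.*2)%N by lia.
have [lt_in|le_ni] := ltnP i.*2 n; last by rewrite bin_small // !mul0r mulr0.
have -> : (n.+1 - i.*2 - 1 = (n - i.*2 - 1).+1)%N by lia.
by rewrite exprS mulrCA.
Qed.

(** The recurrences write the next value as two squares with nonnegative weights plus a positive
    multiple of the present one; the factor [z] covers both signs of [z]. *)
Lemma redei_same_sign d z n : 0 < d -> z != 0 ->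
  0 < z * redeiN d z n.+1 * redeiD d z n.+1.
Proof.
move=> d0 z0; have z20 : 0 < z ^+ 2 by rewrite exprn_even_gt0.
elim: n => [|n IHn].
  by rewrite redeiNS redeiDS redeiN0 redeiD0 !mulr0 !addr0 !mulr1 -expr2.
move: IHn; rewrite [redeiN d z n.+2]redeiNS [redeiD d z n.+2]redeiDS.
set N := redeiN d z n.+1; set D := redeiD d z n.+1 => ND.
have -> : z * (z * N + d * D) * (N + z * D) =
  (z * N) ^+ 2 + (z ^+ 2 + d) * (z * N * D) + d * (z * D) ^+ 2 by ring.
apply: ltr_wpDr; first by rewrite mulr_ge0 ?sqr_ge0 ?ltW.
by apply: ltr_wpDl; [exact: sqr_ge0|rewrite mulr_gt0 ?addr_gt0].
Qed.

Lemma redeiD_neq0 d z n : 0 < d -> z != 0 -> redeiD d z n.+1 != 0.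
Proof.
move=> d0 z0; have := redei_same_sign d z n d0 z0.
by apply: contraTneq => ->; rewrite mulr0 ltxx.
Qed.

Lemma redeiQ1 d z : redeiQ d z 1 = z%:~R.
Proof.
by rewrite /redeiQ redeiNS redeiDS redeiN0 redeiD0 !mulr0 !addr0 mulr1 divr1.
Qed.

Lemma redeiQ_same_sign d z n : 0 < d -> z != 0 ->
  0 < z%:~R * redeiQ d z n.+1.
Proof.
move=> d0 z0; have D0 := redeiD_neq0 d z n d0 z0.
have D20 : 0 < (redeiD d z n.+1)%:~R ^+ 2 :> rat.
  by rewrite exprn_even_gt0 //= intr_eq0.
rewrite -(pmulr_lgt0 _ D20) /redeiQ.
have -> : (z%:~R * ((redeiN d z n.+1)%:~R / (redeiD d z n.+1)%:~R)
     * (redeiD d z n.+1)%:~R ^+ 2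
  = (z * redeiN d z n.+1 * redeiD d z n.+1)%:~R :> rat).
  by field; rewrite intr_eq0.
by rewrite ltr0z redei_same_sign.
Qed.

Lemma redeiQS d z n : 0 < d -> z != 0 ->
  redeiQ d z n.+2 = (z%:~R * redeiQ d z n.+1 + d%:~R) / (redeiQ d z n.+1 + z%:~R).
Proof.
move=> d0 z0; have D0 := redeiD_neq0 d z n d0 z0.
have D1 := redeiD_neq0 d z n.+1 d0 z0.
move: D1; rewrite /redeiQ redeiNS redeiDS.
set N := redeiN d z n.+1; set D := redeiD d z n.+1 => D1.
have {}D1 : (N%:~R + z%:~R * D%:~R : rat) != 0 by rewrite -intrM -intrD intr_eq0.
by rewrite !intrD !intrM; field; rewrite D1 andbT intr_eq0; exact: D0.
Qed.

Lemma redeiQD_neq0 d z n : 0 < d -> z != 0 -> redeiQ d z n.+1 + z%:~R != 0.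
Proof.
move=> d0 z0; have xz := redeiQ_same_sign d z n d0 z0.
apply/eqP => /(congr1 (fun y => z%:~R * y)); rewrite mulr0 mulrDr => E.
suff : 0 < z%:~R * redeiQ d z n.+1 + z%:~R * z%:~R by rewrite E ltxx.
by apply: ltr_wpDr; rewrite // -expr2 sqr_ge0.
Qed.

(** * Convergents of the continued fraction as Rédei functions *)

Lemma cfD a b s : cf (a + b) s = a + cf b s.
Proof. by case: s => //= c s; rewrite addrA. Qed.

(** The head is never inverted, so the head [2z] of a later period may be exchanged for [z]. *)
Lemma cf_defined_head a b s : cf_defined a s = cf_defined b s.
Proof. by case: s. Qed.

Lemma sqrt_quotient_block d z m :
  [seq sqrt_quotient d z i | i <- iota 1 m.+2] =
  (2 * z)%:~R / (d - z ^+ 2)%:~R :: (2 * z)%:~R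
    :: [seq sqrt_quotient d z i | i <- iota 1 m].
Proof.
rewrite /=; congr [:: _, _ & _]; rewrite -[X in iota X]/(2 + 1)%N iotaDl -map_comp.
apply/eq_in_map => i; rewrite mem_iota => /andP[i1 _] /=.
(* Periodicity fails at index 0, where the quotient is [z] and not [2z]; [i1] excludes it. *)
by rewrite /sqrt_quotient /= negbK; case: i i1.
Qed.

(** Splitting the head as [z + z] shows the original continued fraction inside its own tail. *)
Lemma cf_tail d z m : cf (2 * z)%:~R [seq sqrt_quotient d z i | i <- iota 1 m] =
  convergent (sqrt_quotient d z) m + z%:~R.
Proof.
have -> : (2 * z)%:~R = z%:~R + z%:~R :> rat by rewrite -intrD; congr _%:~R; ring.
by rewrite cfD addrC.
Qed.

Lemma nat_ind2 (P : nat -> Prop) :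
  P 0%N -> P 1%N -> (forall n, P n -> P n.+2) -> forall n, P n.
Proof.
move=> P0 P1 PS n; suff [] : P n /\ P n.+1 by [].
by elim: n => // n [Pn PSn]; split=> //; exact: PS.
Qed.

Section Convergents.
Variables (d z : int).
Hypotheses (d_gt0 : 0 < d) (z_neq0 : z != 0) (dz : d - z ^+ 2 != 0).

Let q_neq0 : (d - z ^+ 2)%:~R != 0 :> rat. Proof. by rewrite intr_eq0. Qed.
Let qE : (d - z ^+ 2)%:~R = d%:~R - z%:~R ^+ 2 :> rat.
Proof. by rewrite intrB rmorphXn. Qed.
Let z_neq0Q : z%:~R != 0 :> rat. Proof. by rewrite intr_eq0. Qed.

Lemma odd_tail_numer_neq0 n :
  z%:~R ^+ 2 + d%:~R + 2 * z%:~R * redeiQ d z n.+1 != 0 :> rat.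
Proof.
have xz := redeiQ_same_sign d z n d_gt0 z_neq0.
have d0 : 0 < d%:~R :> rat by rewrite ltr0z.
by rewrite gt_eqF // -mulrA; have := sqr_ge0 (z%:~R : rat); lra.
Qed.

(** The tail starting at an odd index, once the tail after it is known to be
    [redeiQ d z n.+1 + z]. *)
Lemma odd_tail n : (2 * z)%:~R / (d - z ^+ 2)%:~R + (redeiQ d z n.+1 + z%:~R)^-1 =
  (z%:~R ^+ 2 + d%:~R + 2 * z%:~R * redeiQ d z n.+1)
    / ((d - z ^+ 2)%:~R * (redeiQ d z n.+1 + z%:~R)).
Proof.
have xz := redeiQD_neq0 d z n d_gt0 z_neq0.
move: q_neq0; rewrite intrM qE => q0.
by field; rewrite xz q0.
Qed.

Lemma convergent_redeiQ m :
  convergent (sqrt_quotient d z) m = redeiQ d z m.+1.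
Proof.
elim/nat_ind2: m => [||m IHm].
- by rewrite redeiQ1.
- rewrite redeiQS // redeiQ1 /convergent /=.
  rewrite /sqrt_quotient /=; move: q_neq0; rewrite intrM qE => q0.
  by field; rewrite -mulr2n mulrn_eq0 z_neq0Q q0.
have xz := redeiQD_neq0 d z m d_gt0 z_neq0.
have xz1 := redeiQD_neq0 d z m.+1 d_gt0 z_neq0.
have xn := odd_tail_numer_neq0 m.
rewrite /convergent sqrt_quotient_block.
rewrite -[RHS]/(redeiQ d z m.+3) redeiQS //.
have cf_cons a b s : cf a (b :: s) = a + (cf b s)^-1 by [].
rewrite !cf_cons cf_tail IHm odd_tail.
move: xz1; rewrite redeiQS //.
set x := redeiQ d z m.+1 in xz xn * => xz1.
(* The outer denominator of g(g(x)) has the same numerator as [odd_tail], so the nonvanishing of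
   that numerator serves both sides. *)
have -> : (z%:~R * x + d%:~R) / (x + z%:~R) + z%:~R =
  (z%:~R ^+ 2 + d%:~R + 2 * z%:~R * x) / (x + z%:~R) by field.
rewrite qE; field.
by rewrite xz xn -qE.
Qed.

Lemma sqrt_quotient_defined m : convergent_defined (sqrt_quotient d z) m.
Proof.
elim/nat_ind2: m => [||m IHm] //.
  by rewrite /convergent_defined /= andbT mulf_neq0 ?invr_eq0 // intr_eq0 mulf_neq0.
rewrite /convergent_defined sqrt_quotient_block.
have Ed a b s : cf_defined a (b :: s) = (cf b s != 0) && cf_defined b s by [].
rewrite !Ed (cf_defined_head _ (sqrt_quotient d z 0)).
rewrite -/(convergent_defined _ _) IHm andbT.
have cf_cons a b s : cf a (b :: s) = a + (cf b s)^-1 by [].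
have xz := redeiQD_neq0 d z m d_gt0 z_neq0.
rewrite cf_cons cf_tail convergent_redeiQ xz odd_tail andbT.
by rewrite !mulf_neq0 ?invr_eq0 ?mulf_neq0 ?odd_tail_numer_neq0.
Qed.

End Convergents.

(** Stated for an arbitrary root [s], so that it also applies to [-s]. *)
Lemma redei_binomial (K : comNzRingType) (d z : int) (s : K) n :
  s ^+ 2 = d%:~R ->
  (z%:~R + s) ^+ n = (redeiN d z n)%:~R + (redeiD d z n)%:~R * s.
Proof.
move=> s2; elim: n => [|n IHn].
  by rewrite redeiN0 redeiD0 mul0r addr0.
rewrite exprS IHn redeiNS redeiDS !intrD !intrM -s2; ring.
Qed.

(** * Convergence over the reals *)

Section Real.
Variables (R : realType) (d z : int).
Hypotheses (d_gt0 : 0 < d) (z_neq0 : z != 0).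
Let s : R := Num.sg z%:~R * Num.sqrt d%:~R.

Lemma sqrt_signed_sqr : s ^+ 2 = d%:~R.
Proof.
by rewrite exprMn sqr_sg intr_eq0 z_neq0 mul1r sqr_sqrtr // ler0z ltW.
Qed.

Lemma sqrt_signed_neq0 : s != 0.
Proof. by rewrite -sqrf_eq0 sqrt_signed_sqr intr_eq0 gt_eqF. Qed.

Lemma sqrt_signed_mul_gt0 : 0 < z%:~R * s.
Proof.
rewrite mulrA [X in X * _]mulrC -normrEsg.
by rewrite mulr_gt0 ?sqrtr_gt0 ?ltr0z // normr_gt0 intr_eq0.
Qed.

Lemma sqrt_signed_ratio : `|(z%:~R - s) / (z%:~R + s)| < 1.
Proof.
have zs := sqrt_signed_mul_gt0.
have zDs : z%:~R + s != 0.
  by apply/eqP => E; have := sqr_ge0 (z%:~R : R); have := sqr_ge0 s; nra.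
rewrite normrM normfV ltr_pdivrMr ?normr_gt0 // mul1r.
(* The squares of [z + s] and [z - s] differ by [4zs > 0]. *)
by rewrite -(@ltr_pXn2r _ 2) ?nnegrE // !real_normK ?num_real //; nra.
Qed.

(* For n = 0 both sides are 0, by division by 0. *)
Lemma redeiQ_ratio n : let r := (z%:~R - s) / (z%:~R + s) in
  ratr (redeiQ d z n) = s * ((1 + r ^+ n) / (1 - r ^+ n)).
Proof.
have zs := sqrt_signed_mul_gt0.
have zDs : z%:~R + s != 0.
  by apply/eqP => E; have := sqr_ge0 (z%:~R : R); have := sqr_ge0 s; nra.
move=> r; rewrite /redeiQ fmorph_div /= !ratr_int.
have P := redei_binomial R d z s n sqrt_signed_sqr.
have M : (z%:~R - s) ^+ n = (redeiN d z n)%:~R - (redeiD d z n)%:~R * s.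
  by rewrite (redei_binomial R d z) ?sqrrN ?sqrt_signed_sqr // mulrN.
have A0 : (z%:~R + s) ^+ n != 0 by rewrite expf_neq0.
(* Adding and subtracting the expansions [P] and [M] isolates [redeiN] and [redeiD * s]. *)
have -> : 1 + r ^+ n = 2 * (redeiN d z n)%:~R / (z%:~R + s) ^+ n.
  by rewrite exprMn exprVn M -{1}(divff A0) {1}P; ring.
have -> : 1 - r ^+ n = 2 * (redeiD d z n)%:~R * s / (z%:~R + s) ^+ n.
  by rewrite exprMn exprVn M -{1}(divff A0) {1}P; ring.
have [->|D0] := eqVneq ((redeiD d z n)%:~R : R) 0.
  by rewrite mulr0 !mul0r !invr0 !mulr0.
by field; rewrite A0 D0 sqrt_signed_neq0.
Qed.

Lemma redeiQ_cvg_real : (fun n => ratr (redeiQ d z n) : R) @ \oo --> s.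
Proof.
pose r := (z%:~R - s) / (z%:~R + s).
have rn : (fun n => r ^+ n) @ \oo --> (0 : R) by exact: cvg_expr sqrt_signed_ratio.
have -> : (fun n => ratr (redeiQ d z n)) =
    (fun n => s * ((1 + r ^+ n) / (1 - r ^+ n))).
  by apply/funext => n; exact: redeiQ_ratio.
rewrite -[X in _ --> X](_ : s * ((1 + 0) / (1 - 0)) = s); last first.
  by rewrite addr0 subr0 divr1 mulr1.
apply: (@cvgM _ _ _ _ (fun=> s)); first exact: cvg_cst.
apply: cvgM; first by apply: cvgD => //; exact: cvg_cst.
apply: cvgV; first by rewrite subr0 oner_eq0.
by apply: cvgB => //; exact: cvg_cst.
Qed.

End Real.

(** * Convergence over the p-adic numbers *)

Section Padic.
Variables (p : nat) (p_pr : prime p) (d z : int).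
Hypotheses (d_gt0 : 0 < d) (z_neq0 : z != 0).
Hypothesis dz_small :
  padic_norm p (z ^+ 2 - d)%:~R < padic_norm p (2 * z)%:~R ^+ 2.
Local Notation nm := (padic_norm p).
(** The shift starts at Q_1 = z and skips Q_0, whose denominator is 0. *)
Local Notation x n := (redeiQ d z n.+1).
Let t : rat := nm (2 * z)%:~R.
Let k : rat := nm (z ^+ 2 - d)%:~R / t ^+ 2.

Let t_gt0 : 0 < t.
Proof. by rewrite padic_norm_gt0 // intr_eq0 mulf_neq0. Qed.

Let k_ge0 : 0 <= k.
Proof. by rewrite divr_ge0 ?padic_norm_ge0 // exprn_ge0 // ltW. Qed.

Let k_lt1 : k < 1.
Proof. by rewrite ltr_pdivrMr ?mul1r // exprn_gt0. Qed.

(** [y + z] differs from [2z] by [y - z], which has smaller norm, so the ultrametric inequality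
    forces equal norms. *)
Lemma redei_step_normD y : nm (y - z%:~R) < t -> nm (y + z%:~R) = t.
Proof.
move=> yz; apply: (padic_norm_isosceles p_pr); rewrite -/t intrM.
by have -> : y + z%:~R - 2%:~R * z%:~R = y - z%:~R by ring.
Qed.

(** Since g(x) - z = (d - z^2) / (x + z), [dz_small] is exactly what keeps the iterates in the
    ball. *)
Lemma redeiQ_near n : nm (x n - z%:~R) < t.
Proof.
elim: n => [|n IHn]; first by rewrite redeiQ1 subrr padic_norm0.
have xz := redeiQD_neq0 d z n d_gt0 z_neq0.
rewrite redeiQS //.
have -> : (z%:~R * x n + d%:~R) / (x n + z%:~R) - z%:~R =
   - (z ^+ 2 - d)%:~R / (x n + z%:~R) by rewrite intrB rmorphXn /=; field.
rewrite padic_normM // padic_normN // padic_normV // redei_step_normD //.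
by rewrite ltr_pdivrMr // -expr2.
Qed.

Lemma redeiQ_normD n : nm (x n + z%:~R) = t.
Proof. exact/redei_step_normD/redeiQ_near. Qed.

Lemma redeiQ_contract m n : nm (x m.+1 - x n.+1) = k * nm (x m - x n).
Proof.
have xm := redeiQD_neq0 d z m d_gt0 z_neq0.
have xn := redeiQD_neq0 d z n d_gt0 z_neq0.
rewrite !(redeiQS d z) //.
have -> : (z%:~R * x m + d%:~R) / (x m + z%:~R) -
    (z%:~R * x n + d%:~R) / (x n + z%:~R) =
  (z ^+ 2 - d)%:~R * (x m - x n) * ((x m + z%:~R)^-1 * (x n + z%:~R)^-1).
  by rewrite intrB rmorphXn /=; field; rewrite xm xn.
rewrite !padic_normM // !padic_normV // !redeiQ_normD /k.
by field; rewrite gt_eqF.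
Qed.

(** The form a^2 - d b^2 is multiplicative: (zx + d)^2 - d (x + z)^2 = (z^2 - d)(x^2 - d). *)
Lemma redeiQ_norm_sqrB n :
  nm (x n ^+ 2 - d%:~R) = k ^+ n * nm (z ^+ 2 - d)%:~R.
Proof.
elim: n => [|n IHn]; first by rewrite redeiQ1 -rmorphXn -intrB mul1r.
have xn := redeiQD_neq0 d z n d_gt0 z_neq0.
rewrite [k ^+ n.+1]exprS -[RHS]mulrA -IHn redeiQS //.
have -> : ((z%:~R * x n + d%:~R) / (x n + z%:~R)) ^+ 2 - d%:~R =
  (z ^+ 2 - d)%:~R * (x n ^+ 2 - d%:~R) * ((x n + z%:~R)^-1 * (x n + z%:~R)^-1).
  by rewrite intrB rmorphXn /=; field.
rewrite !padic_normM // !padic_normV // !redeiQ_normD /k.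
by field; rewrite gt_eqF.
Qed.

(** After [j] common contractions only the distance of two points of the initial ball remains, which
    is below [t]. *)
Lemma redeiQ_normB m n j : nm (x (m + j) - x (n + j)) <= k ^+ j * t.
Proof.
elim: j => [|j IHj].
  rewrite !addn0 mul1r -(subrKA z%:~R) (le_trans (padic_normD p_pr _ _)) //.
  by rewrite ge_max [nm (z%:~R - _)]padic_normB // !ltW ?redeiQ_near.
by rewrite !addnS redeiQ_contract exprS -mulrA ler_wpM2l.
Qed.

Let small (c e : rat) : 0 <= c -> 0 < e ->
  exists N, forall n, (N <= n)%N -> k ^+ n * c < e.
Proof.
(* Dividing by [c + 1] avoids a division by 0 when [c = 0]. *)
move=> c0 e0; have c1 : 0 < c + 1 by rewrite ltr_wpDl.
have k1 : `|k| < 1 by rewrite ger0_norm.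
have /cvgrPdist_lt /(_ (e / (c + 1)) (divr_gt0 e0 c1))[N _ HN] := cvg_expr k1.
exists N => n Nn; have := HN n Nn.
rewrite /= sub0r normrN ger0_norm ?exprn_ge0 // ltr_pdivlMr //.
by apply: le_lt_trans; rewrite ler_wpM2l ?exprn_ge0 // lerDl.
Qed.

Lemma redeiQ_cauchy : padic_cauchy p_pr (fun n => x n).
Proof.
apply/padic_cauchyP => e e0; have [N HN] := small t e (ltW t_gt0) e0.
exists N => m n Nm Nn; apply: le_lt_trans (HN N (leqnn N)).
by rewrite -(subnK Nm) -(subnK Nn); exact: redeiQ_normB.
Qed.

(** The root is the class of the Cauchy sequence itself; its square is [d] because the sequence of
    x_n^2 - d is null. *)
Lemma redeiQ_cvg_padic : exists2 s : Qp p_pr,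
  s ^+ 2 = d%:~R & (fun n => ratr (x n) : Qp p_pr) @ \oo --> s.
Proof.
exists (\pi_(Qp p_pr)%qT (PadicSeq redeiQ_cauchy)); last exact: Qp_seq_lim.
rewrite -[d%:~R]ratr_int -Qp_cstE /Qp_cst expr2 -Qp_piM.
apply/Qp_eqP/padic_nullP => e e0.
have [N HN] :=
  small (nm (z ^+ 2 - d)%:~R) e (padic_norm_ge0 p _) e0; exists N => n Nn.
by rewrite [padic_seq_val _ _]/(x n ^+ 2 - d%:~R) redeiQ_norm_sqrB HN.
Qed.

End Padic.

(** The convergents have the sign of [z], hence so does the real limit. For [z = 0] every D_n with
    even n would vanish. If p divides 2z, the congruence alone does not suffice: for p = 2, z = 1, d
    = 3 there is no root of d in Q_2. The bound asked for in that case makes g a contraction. *)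
Theorem mainTheorem4 (R : realType) (d : int) (p : nat) (p_pr : prime p)
    (z : int) (d_gt0 : 0 < d) (d_nonsquare : forall m : int, d <> m ^+ 2)
    (z_neq0 : z != 0) (z_sqrt : (z ^+ 2 = d %[mod p])%Z) :
  [/\ forall m : nat, convergent_defined (sqrt_quotient d z) m,
      forall n : nat, (0 < n)%N -> redeiD d z n <> 0,
      (fun m : nat => ratr (convergent (sqrt_quotient d z) m) : R) @ \oo
        --> Num.sg (z%:~R : R) * Num.sqrt (d%:~R : R),
      (fun n : nat => ratr (redeiQ d z n) : R) @ \oo
        --> Num.sg (z%:~R : R) * Num.sqrt (d%:~R : R)
    & ((p %| 2 * z)%Z ->
         padic_norm p (z ^+ 2 - d)%:~R < padic_norm p (2 * z)%:~R ^+ 2) ->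
      exists s : Qp p_pr,
        [/\ s ^+ 2 = d%:~R,
            (fun m : nat => ratr (convergent (sqrt_quotient d z) m) : Qp p_pr)
              @ \oo --> s
          & (fun n : nat => ratr (redeiQ d z n) : Qp p_pr) @ \oo --> s]].
Proof.
have dz : d - z ^+ 2 != 0 by rewrite subr_eq0; apply/eqP; exact: d_nonsquare.
have Ec m := convergent_redeiQ d z d_gt0 z_neq0 dz m.
have cvR := redeiQ_cvg_real R d z d_gt0 z_neq0.
split=> // [m|n n0||H].
- exact: sqrt_quotient_defined.
- by case: n n0 => // n _; apply/eqP; exact: redeiD_neq0.
- rewrite (funext Ec : convergent _ = _).
  (* The m-th convergent is Q_{m+1}, so the limit is that of the sequence shifted by one. *)
  by move: cvR; rewrite -cvg_shiftS.
have dz_small : padic_norm p (z ^+ 2 - d)%:~R < padic_norm p (2 * z)%:~R ^+ 2.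
  (* If p does not divide 2z, then |2z| = 1 and the congruence gives |z^2 - d| < 1. *)
  have [/H//|npz] := boolP (p %| 2 * z)%Z.
  have zz0 : 2 * z != 0 by rewrite mulf_neq0.
  have zd0 : z ^+ 2 - d != 0 by rewrite -opprB oppr_eq0.
  rewrite !padic_norm_int //.
  have -> : logn p `|2 * z| = 0%N.
    by apply/eqP; rewrite -leqn0 leqNgt logn_gt0 mem_primes p_pr absz_gt0 zz0.
  have : (0 < logn p `|(z ^+ 2 - d)%R|)%N.
    rewrite logn_gt0 mem_primes p_pr absz_gt0 zd0 /=.
    by move/eqP: z_sqrt; rewrite eqz_mod_dvd dvdzE.
  case: (logn _ _) => // k _.
  rewrite oppr0 expr0z expr1n -exprnN invf_lt1 ?exprn_gt0 ?ltr0n ?prime_gt0 //.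
  by rewrite exprn_egt1 // ltr1n prime_gt1.
have [s s2 cvs] := redeiQ_cvg_padic p p_pr d z d_gt0 z_neq0 dz_small.
exists s; split; first exact: s2.
  by rewrite (funext Ec : convergent _ = _); exact: cvs.
by rewrite -cvg_shiftS; exact: cvs.
Qed.
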